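(* Let $t,b,k$ be positive integers with $3\le k\le t$. Let $l^*$ be a sequence of length $k$ with entries in $\{1,\dots,t\}$ that maximizes $c(l)$ over all such sequences, let $v^*$ be the number of distinct treatments occurring in $l^*$, and let $s^*$ be the set of all sequences obtained from $l^*$ by relabelling the treatments (applying a permutation of $\{1,\dots,t\}$ entrywise). Let $d^*$ be a circular design with $b$ blocks of length $k$ whose inner-plot sequences $(d^*(i,1),\dots,d^*(i,k))$ all lie in $s^*$, each sequence of $s^*$ occurring as the inner-plot sequence of the same number of blocks. Then under model $(\mathcal{M}1)$, $d^*$ is universally optimal for the total effects $\phi=\tau+\lambda$ among all circular designs with $t$ treatments and $b$ blocks of length $k$, and $\mathrm{tr}(C_{d^*}[\phi])=bf(v^* )=bc(l^* )$.
   Context: Designs: $t$ treatments, $b$ linear blocks; block $i$ has inner plots $j=1,\dots,k$ and border plots $j=0,k+1$; a design $d$ assigns treatment $d(i,j)$ to each plot and is circular if $d(i,0)=d(i,k)$, $d(i,k+1)=d(i,1)$. Model $(\mathcal{M}1)$: responses $Y_{i,j}$ ($1\le i\le b$, $1\le j\le k$) uncorrelated with common variance, $\mathbb{E}(Y)=B\beta+T_d\tau+L_d\lambda$ where $B$ is the block incidence matrix and $T_d,L_d$ ($bk\times t$) have in row $(i,j)$ a single $1$ in column $d(i,j)$, resp. $d(i,j-1)$. Total effects $\phi=K'\alpha$, $\alpha=(\tau',\lambda')'$, $K=\mathbf{1}_2\otimes I_t$. Information matrix: with $A^+$ the Moore–Penrose inverse, $\mathrm{pr}_{(A)}=A(A'A)^+A'$,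 $\mathrm{pr}^\perp_{(A)}=I-\mathrm{pr}_{(A)}$, $A=(T_d\mid L_d)$, $M=I-K(K'K)^+K'$, $X_1=AK(K'K)^+$, $X_2=(AM\mid B)$, one sets $C_d[\phi]=X_1'\mathrm{pr}^\perp_{(X_2)}X_1$. For a sequence $l=(l_1,\dots,l_k)$ with entries in $\{1,\dots,t\}$, put $l_0=l_k$; let $n_i$ be the number of occurrences of $i$ in $l$ and $m_i$ the number of $j\in\{1,\dots,k\}$ with $l_{j-1}=l_j=i$; define $c(l)=\frac12\big(k-\frac2k\sum_{i=1}^t n_i^2+\sum_{i=1}^t m_i\big)$. Define $f(v)=-1+k-v/2-(2-v/k)\lfloor k/v\rfloor+(v/k)\lfloor k/v\rfloor^2$. Universal optimality (Kiefer): $d^*$ is universally optimal over $\mathcal{D}$ if $\Phi(C_{d^*})\le\Phi(C_d)$ for all $d\in\mathcal{D}$ and every $\Phi$ on nonnegative definite symmetric $t\times t$ matrices, valued in $(-\infty,\infty]$, that is convex, has $\Phi(aC)$ nonincreasing in $a\ge0$, and is invariant under simultaneous permutation of rows and columns. *)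

(* Defs.v *)
From HB Require Import structures.
From Stdlib Require Import ClassicalEpsilon.
From mathcomp Require Import all_boot all_order all_algebra all_fingroup.
From mathcomp Require Import reals constructive_ereal.
Set Implicit Arguments. Unset Strict Implicit. Unset Printing Implicit Defensive.
Import Order.TTheory GRing.Theory Num.Theory.
Local Open Scope ring_scope.

Section Defs.
Variable R : realType.

Definition is_mpinv m n (A : 'M[R]_(m, n)) (X : 'M[R]_(n, m)) : Prop :=
  [/\ A *m X *m A = A, X *m A *m X = X,
      (A *m X)^T = A *m X & (X *m A)^T = X *m A].

Definition mpinv m n (A : 'M[R]_(m, n)) : 'M[R]_(n, m) :=
  epsilon (inhabits 0) (is_mpinv A).

Definition proj m n (A : 'M[R]_(m, n)) : 'M[R]_m := A *m mpinv (A^T *m A) *m A^T.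
Definition projperp m n (A : 'M[R]_(m, n)) : 'M[R]_m := 1%:M - proj A.

(* Treatments are 'I_t (i.e. 0..t-1 instead of 1..t); blocks are 'I_b;
   plots of a block are 'I_(k.+2): plot 0 and plot k+1 are the border plots,
   plots 1..k are the inner plots. *)
Definition design (t b k : nat) := 'I_b -> 'I_k.+2 -> 'I_t.

Definition circular t b k (d : design t b k) : Prop :=
  forall i : 'I_b, d i ord0 = d i (inord k) /\ d i ord_max = d i (inord 1).

Definition inner_seq t b k (d : design t b k) (i : 'I_b) : {ffun 'I_k -> 'I_t} :=
  [ffun j : 'I_k => d i (inord j.+1)].

(* observations are indexed by pairs (i, j) (block, inner plot);
   row r of the bk-row model matrices corresponds to enum_val r,
   where the pair (i, j) with j : 'I_k stands for inner plot j+1. *)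
Definition obs b k := ('I_b * 'I_k)%type.
Definition nobs b k := #|{: obs b k}|.
Definition decode b k (r : 'I_(nobs b k)) : obs b k := enum_val r.

Definition Tmat t b k (d : design t b k) : 'M[R]_(nobs b k, t) :=
  \matrix_(r, c) (d (decode r).1 (inord (decode r).2.+1) == c)%:R.
Definition Lmat t b k (d : design t b k) : 'M[R]_(nobs b k, t) :=
  \matrix_(r, c) (d (decode r).1 (inord (decode r).2) == c)%:R.
Definition Bmat b k : 'M[R]_(nobs b k, b) :=
  \matrix_(r, c) ((decode r).1 == c)%:R.

Definition Amat t b k (d : design t b k) : 'M[R]_(nobs b k, t + t) :=
  row_mx (Tmat d) (Lmat d).
Definition Kmat t : 'M[R]_(t + t, t) := col_mx 1%:M 1%:M.
Definition Mmat t : 'M[R]_(t + t) :=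
  1%:M - Kmat t *m mpinv ((Kmat t)^T *m Kmat t) *m (Kmat t)^T.
Definition X1mat t b k (d : design t b k) : 'M[R]_(nobs b k, t) :=
  Amat d *m Kmat t *m mpinv ((Kmat t)^T *m Kmat t).
Definition X2mat t b k (d : design t b k) : 'M[R]_(nobs b k, (t + t) + b) :=
  row_mx (Amat d *m Mmat t) (Bmat b k).

Definition info t b k (d : design t b k) : 'M[R]_t :=
  (X1mat d)^T *m projperp (X2mat d) *m X1mat d.

(* l : sequence (l_1,...,l_k) stored 0-based; cyclic predecessor realises l_0 = l_k *)
Definition n_occ t k (l : {ffun 'I_k -> 'I_t}) (i : 'I_t) : nat :=
  #|[set j : 'I_k | l j == i]|.
Definition m_occ t k (l : {ffun 'I_k -> 'I_t}) (i : 'I_t) : nat :=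
  #|[set j : 'I_k | (l (ord_pred j) == i) && (l j == i)]|.
Definition cval t k (l : {ffun 'I_k -> 'I_t}) : R :=
  2^-1 * (k%:R - 2 / k%:R * (\sum_(i < t) ((n_occ l i) ^ 2)%:R)
          + \sum_(i < t) (m_occ l i)%:R).
Definition fval (k v : nat) : R :=
  -1 + k%:R - v%:R / 2 - (2 - v%:R / k%:R) * (k %/ v)%:R
  + v%:R / k%:R * ((k %/ v) ^ 2)%:R.

Definition ndistinct t k (l : {ffun 'I_k -> 'I_t}) : nat := #|[set l j | j : 'I_k]|.

Definition relabel t k (s : {perm 'I_t}) (l : {ffun 'I_k -> 'I_t}) : {ffun 'I_k -> 'I_t} :=
  [ffun j => s (l j)].

Definition nnd t (C : 'M[R]_t) : Prop :=
  C^T = C /\ forall x : 'cV[R]_t, 0 <= (x^T *m C *m x) 0 0.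

Local Open Scope ereal_scope.
(* Phi : nnd symmetric matrices -> (-oo, +oo], convex, nonincreasing under
   scaling, and permutation invariant.  Phi is a total function on matrices,
   but all requirements only concern its values on nnd symmetric matrices. *)
Definition kiefer_criterion t (Phi : 'M[R]_t -> \bar R) : Prop :=
  [/\ (forall C : 'M[R]_t, nnd C -> Phi C != -oo),
      (forall (A B : 'M[R]_t) (a : R), nnd A -> nnd B -> (0 < a)%R -> (a < 1)%R ->
         Phi (a *: A + (1 - a) *: B)%R <= a%:E * Phi A + (1 - a)%:E * Phi B),
      (forall (C : 'M[R]_t) (a a' : R), nnd C -> (0 <= a)%R -> (a <= a')%R ->
         Phi (a' *: C)%R <= Phi (a *: C)%R) &
      (forall (C : 'M[R]_t) (s : 'S_t), nnd C ->
         Phi (\matrix_(i, j) C (s i) (s j)) = Phi C)].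
Local Close Scope ereal_scope.

Definition universally_optimal t b k (dstar : design t b k) : Prop :=
  forall Phi : 'M[R]_t -> \bar R, kiefer_criterion Phi ->
  forall d : design t b k, circular d -> (Phi (info dstar) <= Phi (info d))%E.

End Defs.

(* Main.v *)
Require Import Defs.
From HB Require Import structures.
From Stdlib Require Import ClassicalEpsilon.
From mathcomp Require Import all_boot all_order all_algebra all_fingroup.
From mathcomp Require Import reals constructive_ereal ring lra zify.
Import Order.TTheory GRing.Theory Num.Theory.
Local Open Scope ring_scope.

Set Implicit Arguments. Unset Strict Implicit. Unset Printing Implicit Defensive.

(* The columns of [X_2] span the same space as [T - L] and [B], and
   [X_1 = (T + L) / 2].  Removing only the block effects gives an upper bound
   for [C_d] whose trace, for a circular design, is the sum of [c] over the
   blocks, hence at most [b c(l^* )].  For a design that is invariant under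
   relabelling, [T' L] is symmetric, so that [T - L] is orthogonal to [T + L]
   and the bound is attained.  The matrix [C_(d^* )] is then a multiple of the
   centering matrix, and symmetrizing any competitor gives a smaller multiple
   of it.

   For a non-constant sequence with [v] treatments, at least [v] cyclic
   neighbours differ, and the squared multiplicities sum to least when they
   are all [q] or [q + 1], where [q] is the integer part of [k / v]; the
   sequence [j |-> floor (j v / k)] attains both bounds, so that the maximum
   of [c] over such sequences is [f v]. *)

(** * Orthogonal projections *)

Section MoorePenrose.
Variable R : realType.

Lemma gram_eq0 m n (A : 'M[R]_(m, n)) : A^T *m A = 0 -> A = 0.
Proof.
move=> A0; apply/matrixP => i j; rewrite mxE.
have /matrixP/(_ j j) := A0; rewrite !mxE => /psumr_eq0P H.
have /H/(_ i isT)/eqP : forall l, true -> 0 <= A^T j l * A l j.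
  by move=> l _; rewrite mxE -expr2 sqr_ge0.
by rewrite mxE mulf_eq0 orbb => /eqP.
Qed.

(** If [u] annihilates [A' A], then [A u'] has a zero Gram matrix, hence vanishes, and a left
    inverse of [A] gives [u = 0]. *)
Lemma gram_unit m n (A : 'M[R]_(m, n)) : row_full A -> A^T *m A \in unitmx.
Proof.
move=> /row_fullP[B BA]; rewrite -row_free_unit; apply/inj_row_free => u uA.
have /gram_eq0 Au : (A *m u^T)^T *m (A *m u^T) = 0.
  by rewrite trmx_mul trmxK mulmxA -[u *m _ *m _]mulmxA uA mul0mx.
by apply: trmx_inj; rewrite -[u^T]mul1mx -BA -mulmxA Au mulmx0 trmx0.
Qed.

(* The inverse is [G^+ F^+], with [F^+] a left
   and [G^+] a right inverse built from invertible Gram matrices. *)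
Lemma mpinv_mul m n r (F : 'M[R]_(m, r)) (G : 'M[R]_(r, n)) :
  row_full F -> row_free G -> exists X, is_mpinv (F *m G) X.
Proof.
move=> Ffull Gfree; set Gt := G^T.
have Fu : F^T *m F \in unitmx by exact: gram_unit.
have Gu : Gt^T *m Gt \in unitmx.
  by apply: gram_unit; rewrite /row_full mxrank_tr.
pose Fl := invmx (F^T *m F) *m F^T; pose Gr := Gt *m invmx (Gt^T *m Gt).
have FlF : Fl *m F = 1%:M by rewrite -mulmxA mulVmx.
have GGr : G *m Gr = 1%:M by rewrite mulmxA -[G]trmxK mulmxV.
have AX : F *m G *m (Gr *m Fl) = F *m Fl.
  by rewrite -mulmxA (mulmxA G) GGr mul1mx.
have XA : Gr *m Fl *m (F *m G) = Gr *m G.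
  by rewrite -mulmxA (mulmxA Fl) FlF mul1mx.
exists (Gr *m Fl); split.
- by rewrite AX -mulmxA (mulmxA Fl) FlF mul1mx.
- by rewrite XA -mulmxA (mulmxA G) GGr mul1mx.
- by rewrite AX /Fl !(trmx_mul, trmx_inv, trmxK) mulmxA.
- by rewrite XA /Gr !(trmx_mul, trmx_inv, trmxK) mulmxA.
Qed.

(** By full-rank factorization. Existence is what makes the [epsilon] in [mpinv] satisfy the Penrose
    equations. *)
Lemma mpinv_exists m n (A : 'M[R]_(m, n)) : exists X, is_mpinv A X.
Proof.
rewrite -(mulmx_base A); apply: mpinv_mul; last exact: row_base_free.
exact: col_base_full.
Qed.

Lemma mpinvP m n (A : 'M[R]_(m, n)) : is_mpinv A (mpinv A).
Proof. exact: epsilon_spec (mpinv_exists A). Qed.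

Lemma mpinv_scalar n (a : R) : a != 0 -> mpinv (a%:M : 'M_n) = a^-1%:M.
Proof.
move=> a0; have [+ _ _ _] := mpinvP (a%:M : 'M_n).
rewrite mul_scalar_mx mul_mx_scalar scalerA -[X in _ = X]scalemx1 => H.
rewrite -[mpinv _](scalerK (mulf_neq0 a0 a0)) H scalerA invfM -mulrA.
by rewrite mulVf // mulr1 scalemx1.
Qed.

(** With [S = X' X] and [G] its inverse, [X - X G S] is killed by [X'] because [S G S = S]; so its
    Gram matrix is zero. *)
Lemma projX m n (X : 'M[R]_(m, n)) : proj X *m X = X.
Proof.
have [SGS _ _ _] := mpinvP (X^T *m X); rewrite /proj.
set S := X^T *m X in SGS *; set G := mpinv S in SGS *.
apply/esym/subr0_eq/gram_eq0.
have -> : X - X *m G *m X^T *m X = X *m (1%:M - G *m S).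
  by rewrite mulmxBr mulmx1 !mulmxA.
have E : X^T *m (X *m (1%:M - G *m S)) = 0.
  by rewrite mulmxA -/S mulmxBr mulmx1 mulmxA SGS subrr.
by rewrite trmx_mul -mulmxA E mulmx0.
Qed.

(** The transpose [P'] begins with a factor [X], so [projX] gives [P P' = P'], whose left side is
    symmetric. *)
Lemma proj_sym m n (X : 'M[R]_(m, n)) : (proj X)^T = proj X.
Proof.
have PT : (proj X)^T = X *m ((mpinv (X^T *m X))^T *m X^T).
  by rewrite /proj !trmx_mul trmxK.
have := projX X; move: (proj X) PT => P PT PX.
have E : P^T = P *m P^T by rewrite PT [RHS]mulmxA PX.
by rewrite -[RHS]trmxK E trmx_mul trmxK.
Qed.

Lemma proj_idem m n (X : 'M[R]_(m, n)) : proj X *m proj X = proj X.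
Proof. by rewrite {2}/proj !mulmxA projX. Qed.

Lemma projperpX m n (X : 'M[R]_(m, n)) : projperp X *m X = 0.
Proof. by rewrite mulmxBl mul1mx projX subrr. Qed.

Lemma projperp_sym m n (X : 'M[R]_(m, n)) : (projperp X)^T = projperp X.
Proof. by rewrite linearB /= trmx1 proj_sym. Qed.

Lemma projperp_idem m n (X : 'M[R]_(m, n)) :
  projperp X *m projperp X = projperp X.
Proof. by rewrite mulmxBl mul1mx mulmxBr mulmx1 proj_idem subrr subr0. Qed.

Lemma mxtrace_gram_ge0 m n (A : 'M[R]_(m, n)) : 0 <= \tr (A^T *m A).
Proof.
apply: sumr_ge0 => i _; rewrite mxE; apply: sumr_ge0 => j _.
by rewrite mxE -expr2 sqr_ge0.
Qed.

Lemma mxtrace_projperp_le m n p (X : 'M[R]_(m, n)) (Y : 'M[R]_(m, p)) :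
  \tr (Y^T *m projperp X *m Y) <= \tr (Y^T *m Y).
Proof.
rewrite mulmxBr mulmx1 mulmxBl linearB /= gerBl -proj_idem -{1}proj_sym.
by have := mxtrace_gram_ge0 (proj X *m Y); rewrite trmx_mul !mulmxA.
Qed.

Lemma nnd_gram m n (A : 'M[R]_(m, n)) : nnd (A^T *m A).
Proof.
split=> [|x]; first by rewrite trmx_mul trmxK.
have := mxtrace_gram_ge0 (A *m x).
by rewrite /mxtrace big_ord1 trmx_mul -!mulmxA.
Qed.

End MoorePenrose.

(** * Optimal sequences *)

Section Sequences.
Local Open Scope nat_scope.
Variables t k : nat.
Implicit Types (l : {ffun 'I_k -> 'I_t}) (i : 'I_t).

Definition switches l : {set 'I_k} := [set j | l (ord_pred j) != l j].

Lemma sum_n_occ l : \sum_(i < t) n_occ l i = k.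
Proof.
rewrite -[RHS]card_ord -sum1_card (partition_big l xpredT) //=.
by apply: eq_bigr => i _; rewrite sum1dep_card.
Qed.

Lemma sum_m_occ l : \sum_(i < t) m_occ l i + #|switches l| = k.
Proof.
rewrite -[RHS]card_ord -(cardC [pred j | l (ord_pred j) == l j]); congr (_ + _).
  rewrite -sum1_card (partition_big l xpredT) //=.
  apply: eq_bigr => i _; rewrite sum1dep_card; apply: eq_card => j.
by rewrite !inE /=; case: (l j =P i) => [->|_]; rewrite ?andbT ?andbF.
by apply: eq_card => j; rewrite !inE.
Qed.

Lemma n_occ_eq0 l i : (n_occ l i == 0) = (i \notin [set l j | j : 'I_k]).
Proof.
rewrite cards_eq0; apply/eqP/idP => [E|/imsetP N].
  apply/imsetP => -[j _ ij]; have : j \in (set0 : {set 'I_k}).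
    by rewrite -E inE ij.
  by rewrite inE.
apply/setP => j; rewrite !inE; apply/eqP => E; apply: N.
by exists j.
Qed.

(** Descending from any element reaches [0], whose cyclic predecessor is [k - 1]; descending from
    there reaches every position. *)
Lemma ord_pred_closed (A : {set 'I_k}) :
  {in A, forall j, ord_pred j \in A} -> A != set0 -> A = setT.
Proof.
move=> Apred /set0Pn[j0 Aj0].
have down n (j : 'I_k) : n <= j -> j \in A ->
    forall j' : 'I_k, j' + n = j :> nat -> j' \in A.
  elim: n j => [|n IH] j nj jA j' E.
    by have -> : j' = j by apply: val_inj => /=; lia.
  apply: (IH (ord_pred j)); rewrite ?Apred //=;
    have -> : (j + k).-1 %% k = j.-1; try lia;
    have -> : (j + k).-1 = j.-1 + k by [lia];
    by rewrite modnDr modn_small //; have := ltn_ord j; lia.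
have k_gt0 : 0 < k by apply: leq_ltn_trans (ltn_ord j0).
have A0 : Ordinal k_gt0 \in A by apply: (down j0 j0).
have := Apred _ A0; set jm := ord_pred _ => Ajm.
have jmE : jm = k.-1 :> nat by rewrite /= add0n modn_small // prednK.
apply/setP => j; rewrite inE; apply: (down (k.-1 - j) jm) => //;
  rewrite jmE ?leq_subr //; have := ltn_ord j; lia.
Qed.

(** Every treatment occurs at some switch: otherwise its set of positions would be closed under
    predecessor, hence everything, and the sequence constant. *)
Lemma ndistinct_le_switches l : 1 < ndistinct l -> ndistinct l <= #|switches l|.
Proof.
move=> l2; apply: leq_trans (leq_imset_card l _); apply: subset_leq_card.
apply/subsetP => _ /imsetP[j0 _ ->]; apply/imsetP.
case: (pickP [pred j in switches l | l j == l j0]) => [j /andP[js /eqP E]|N].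
  by exists j.
suff E : [set j | l j == l j0] = setT.
  move: l2; suff -> : ndistinct l = 1 by [].
  apply/eqP/cards1P; exists (l j0); apply/setP => i; rewrite inE.
  apply/imsetP/eqP => [[j _ ->]|->]; last by exists j0.
  by apply/eqP; have : j \in setT by []; rewrite -E inE.
apply: ord_pred_closed; last by apply/set0Pn; exists j0; rewrite inE.
move=> j; rewrite !inE => ljE; have := N j; rewrite /= inE ljE andbT.
by move/negbFE/eqP => ->.
Qed.

End Sequences.

(** * Bounds for the value of a sequence, and a sequence attaining them *)

Section Value.
Variables (R : realType) (t k : nat).
Implicit Types (l : {ffun 'I_k -> 'I_t}) (i : 'I_t).

(* The value of [fval] when the squares sum to [(2q+1) k - v q (q+1)], which
   is the case exactly when every multiplicity is [q] or [q+1]. *)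
Lemma fvalE v : (0 < k)%N -> let q := (k %/ v)%N in
  fval R k v = 2^-1 * (k%:R - 2 / k%:R *
     ((2 * q%:R + 1) * k%:R - v%:R * (q%:R * (q%:R + 1))) + (k%:R - v%:R)).
Proof.
move=> k0 q; rewrite /fval -/q natrX; field.
by rewrite pnatr_eq0 -lt0n.
Qed.

(** For integers, [(n - q) (n - q - 1) >= 0], that is [n^2 >= (2 q + 1) n - q (q + 1)]; this is
    summed over the treatments that occur. *)
Lemma sum_sq_ge l (q : nat) :
  (2 * q%:R + 1) * k%:R - (ndistinct l)%:R * (q%:R * (q%:R + 1))
    <= \sum_(i < t) ((n_occ l i) ^ 2)%:R :> R.
Proof.
set S := [set l j | j : 'I_k].
have -> : k%:R = \sum_(i in S) (n_occ l i)%:R :> R.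
  rewrite -[in LHS](sum_n_occ l) natr_sum [LHS](bigID (mem S)) /= [X in _ + X]big1 ?addr0 //.
  by move=> i; rewrite -n_occ_eq0 => /eqP ->.
rewrite [leRHS](bigID (mem S)) /= [X in _ <= _ + X]big1 ?addr0; last first.
  by move=> i; rewrite -n_occ_eq0 => /eqP ->.
rewrite mulr_sumr /ndistinct -/S -sum1_card natr_sum mulr_suml -sumrB.
apply: ler_sum => i _; rewrite natrX mul1r.
have [nq|qn] := leqP (n_occ l i) q.
  have : (n_occ l i)%:R <= q%:R :> R by rewrite ler_nat.
  nra.
have : q%:R + 1 <= (n_occ l i)%:R :> R by rewrite natr1 ler_nat.
nra.
Qed.

Lemma cval_le_fval l : (0 < k)%N -> (1 < ndistinct l)%N ->
  cval R l <= fval R k (ndistinct l).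
Proof.
move=> k0 l2; rewrite fvalE // ler_pM2l ?invr_gt0 //.
apply: lerD; first rewrite lerB // ler_wpM2l ?sum_sq_ge //.
  by rewrite divr_ge0.
rewrite -natr_sum lerBrDr -natrD ler_nat.
apply: leq_trans (leq_add (leqnn _) (ndistinct_le_switches l2)) _.
by rewrite sum_m_occ.
Qed.

Variable v : nat.
Hypotheses (v_gt0 : (0 < v)%N) (vk : (v <= k)%N) (vt : (v <= t)%N).

Lemma block_subproof (j : 'I_k) : (j * v %/ k < t)%N.
Proof.
apply: leq_trans vt; rewrite ltn_divLR; last exact: leq_trans vk.
by rewrite mulnC ltn_pmul2l.
Qed.

Definition block_seq : {ffun 'I_k -> 'I_t} :=
  [ffun j => Ordinal (block_subproof j)].

(** The sequence is nondecreasing, so a position whose value already occurred earlier is no switch.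
    Hence the sequence is injective on its switches, with fewer than [v + 1] values. *)
Lemma card_block_switches : (#|switches block_seq| <= v)%N.
Proof.
have k0 : (0 < k)%N by exact: leq_trans vk.
have inj : {in switches block_seq &, injective block_seq}.
  suff H (j j' : 'I_k) : (j < j')%N -> block_seq j = block_seq j' ->
      j' \notin switches block_seq.
    move=> j j' js j's E; apply: val_inj; apply/eqP; case: ltngtP => // lt.
      by have := H _ _ lt E; rewrite j's.
    by have := H _ _ lt (esym E); rewrite js.
  move=> jj'; rewrite !ffunE => /(congr1 val) /= E; rewrite inE negbK !ffunE.
  apply/eqP/val_inj => /=.
  have -> : ((j' + k).-1 %% k = j'.-1)%N.
    have -> : ((j' + k).-1 = j'.-1 + k)%N by lia.
    by rewrite modnDr modn_small //; have := ltn_ord j'; lia.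
  apply/eqP; rewrite eqn_leq leq_div2r ?leq_mul2r ?leq_pred ?orbT //=.
  by rewrite -E leq_div2r // leq_mul2r; apply/orP; right; lia.
rewrite -(card_in_imset inj) -[leqRHS]card_ord.
pose w (i : 'I_v) : 'I_t := widen_ord vt i.
rewrite -(card_imset _ (f := w)); last by move=> i i' /(congr1 val) /= /val_inj.
apply: subset_leq_card; apply/subsetP => _ /imsetP[j _ ->].
have jv : (j * v %/ k < v)%N by rewrite ltn_divLR // mulnC ltn_pmul2l.
by apply/imsetP; exists (Ordinal jv) => //; apply: val_inj; rewrite ffunE.
Qed.


(** The positions with value [i] are the integers [j] with [i k <= j v < (i + 1) k], a half-open
    interval of length [k / v]. *)
Lemma n_occ_block_seq (i : 'I_t) : (i < v)%N ->
  let q := (k %/ v)%N in n_occ block_seq i = q \/ n_occ block_seq i = q.+1.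
Proof.
move=> iv q; set n := n_occ _ _.
have k0 : (0 < k)%N by exact: leq_trans vk.
have qv : (q * v <= k)%N by rewrite leq_trunc_div.
have kq : (k < q.+1 * v)%N by rewrite ltn_ceil.
have classE (j : 'I_k) : (block_seq j == i) = (i * k <= j * v < i.+1 * k)%N.
  by rewrite ffunE -val_eqE /= eqn_leq -ltnS ltn_divLR // leq_divRL // andbC.
(* [j0] is [i k / v] rounded up, the first position of the run. The run contains the [q] positions
   from [j0] on and lies within the [q + 1] positions from [j0] on. *)
pose j0 := ((i * k + v).-1 %/ v)%N.
have j0v : (i * k <= j0 * v)%N.
  by have := ltn_ceil (i * k + v).-1 v_gt0; rewrite -/j0; lia.
have j0v' : (j0 * v <= (i * k + v).-1)%N by rewrite leq_trunc_div.
have ikv : (i.+1 * k <= v * k)%N by rewrite leq_mul2r iv orbT.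
have lo : (q <= n)%N.
  have jk (p : 'I_q) : ((j0 + p) * v < i.+1 * k)%N.
    have : ((j0 + p).+1 * v <= j0 * v + q * v)%N.
      by rewrite -mulnDl leq_mul2r -addnS leq_add2l ltn_ord orbT.
    lia.
  have jk' (p : 'I_q) : (j0 + p < k)%N.
    by rewrite -(ltn_pmul2r v_gt0) [(k * v)%N]mulnC; apply: leq_trans ikv.
  pose g p := Ordinal (jk' p).
  rewrite -[leqLHS]card_ord -(card_imset _ (f := g)); last first.
    by move=> p p' /(congr1 val) /= /addnI /val_inj.
  apply: subset_leq_card; apply/subsetP => _ /imsetP[p _ ->].
  by rewrite inE classE /= jk andbT mulnDl (leq_trans j0v) ?leq_addr.
have hi : (n <= q.+1)%N.
  have jlo (j : 'I_k) : block_seq j == i -> (j0 <= j)%N.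
    rewrite classE => /andP[ij _]; rewrite -ltnS -(ltn_pmul2r v_gt0); lia.
  have jhi (j : 'I_k) : block_seq j == i -> (j < j0 + q.+1)%N.
    rewrite classE => /andP[_ ji]; rewrite -(ltn_pmul2r v_gt0) mulnDl; lia.
  rewrite -[leqRHS]card_ord.
  pose g (j : 'I_k) : 'I_q.+1 := inord (j - j0).
  rewrite /n /n_occ -(card_in_imset (f := g)) ?max_card // => j j'.
  rewrite !inE => ji j'i /(congr1 val); rewrite /= !inordK => [E||];
    have := jlo _ ji; have := jlo _ j'i; have := jhi _ ji; have := jhi _ j'i.
  - by move=> *; apply: val_inj => /=; lia.
  - by lia.
  - by lia.
lia.
Qed.

(** The inequality behind [sum_sq_ge] is an equality at the multiplicities [q] and [q + 1];
    treatments from [v] on contribute nothing. *)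
Lemma fval_le_cval_block : fval R k v <= cval R block_seq.
Proof.
have k0 : (0 < k)%N by exact: leq_trans vk.
rewrite fvalE // ler_pM2l ?invr_gt0 //.
set q := (k %/ v)%N.
have out i : ~~ (i < v)%N -> n_occ block_seq i = 0%N.
  move=> iv; apply/eqP; rewrite n_occ_eq0; apply: contra iv => /imsetP[j _ ->].
  by rewrite ffunE /= ltn_divLR // mulnC ltn_pmul2l.
have card_lt : #|[pred i : 'I_t | (i < v)%N]| = v.
  rewrite -[RHS]card_ord -(card_image (f := widen_ord vt)); last first.
    by move=> i i' /(congr1 val) /= /val_inj.
  apply: eq_card => i; rewrite inE; apply/idP/imageP => [iv|[i' _ ->]].
    by exists (Ordinal iv) => //; apply: val_inj.
  exact: (ltn_ord i').
apply: lerD; last first.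
  by rewrite -natr_sum lerBlDr -natrD ler_nat -[leqLHS](sum_m_occ block_seq)
    leq_add2l card_block_switches.
rewrite lerB // ler_wpM2l ?divr_ge0 //.
rewrite [leLHS](bigID [pred i : 'I_t | (i < v)%N]) /= [X in _ + X <= _]big1; last first.
  by move=> i /out ->.
have -> : k%:R = \sum_(i < t | (i < v)%N) (n_occ block_seq i)%:R :> R.
  rewrite -[in LHS](sum_n_occ block_seq) natr_sum
    [LHS](bigID [pred i : 'I_t | (i < v)%N]) /= [X in _ + X]big1 ?addr0 //.
  by move=> i /out ->.
have vE : v%:R = \sum_(i < t | (i < v)%N) 1 :> R.
  by rewrite -[in LHS]card_lt -sum1_card natr_sum.
rewrite addr0 mulr_sumr [X in _ - X * _]vE mulr_suml -sumrB.
apply: ler_sum => i iv; rewrite natrX mul1r.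
have [->|->] := n_occ_block_seq iv; rewrite -/q -?natr1; lra.
Qed.

End Value.

(** The lower bound compares [l] with the [block_seq] having as many treatments; the upper bound
    requires [l] not to be constant. *)
Lemma cval_max_eq_fval (R : realType) (t k : nat) (l : {ffun 'I_k -> 'I_t}) :
  (3 <= k)%N -> (k <= t)%N ->
  (forall l' : {ffun 'I_k -> 'I_t}, cval R l' <= cval R l) ->
  cval R l = fval R k (ndistinct l).
Proof.
move=> k3 kt lmax; have k0 : (0 < k)%N by exact: leq_trans k3.
have vt : (ndistinct l <= t)%N.
  by rewrite -[leqRHS]card_ord max_card.
have vk : (ndistinct l <= k)%N.
  by rewrite -[leqRHS]card_ord leq_imset_card.
have v0 : (0 < ndistinct l)%N.
  rewrite card_gt0; apply/set0Pn; exists (l (Ordinal k0)).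
  by apply: imset_f.
suff v2 : (1 < ndistinct l)%N.
  apply/le_anti; rewrite cval_le_fval //=.
  exact: le_trans (fval_le_cval_block R v0 vk vt) (lmax _).
(* A constant sequence has value [0] (whereas [fval k 1] is negative), and it
   is beaten by the sequence of [k] distinct treatments. *)
rewrite ltnNge; apply/negP => v1.
have := le_trans (fval_le_cval_block R k0 (leqnn k) kt) (lmax _).
(* With one treatment, the choice [q = k] makes the lower bound exactly [k^2]. *)
have sq := sum_sq_ge R l k.
have m_le : \sum_(i < t) (m_occ l i)%:R <= k%:R :> R.
  by rewrite -natr_sum ler_nat -[leqRHS](sum_m_occ l) leq_addr.
have v1E : ndistinct l = 1%N by apply/eqP; rewrite eqn_leq v1 v0.
rewrite v1E in sq; apply/negP; rewrite -ltNge.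
have kR : 3 <= k%:R :> R by rewrite (ler_nat R 3).
have k0R : k%:R != 0 :> R by rewrite pnatr_eq0 -lt0n.
apply: (@le_lt_trans _ _ 0).
  have : 2 / k%:R * (k%:R * k%:R) <=
      2 / k%:R * \sum_(i < t) (n_occ l i ^ 2)%:R :> R.
    rewrite ler_wpM2l ?divr_ge0 //; apply: le_trans sq; lra.
  have -> : 2 / k%:R * (k%:R * k%:R) = 2 * k%:R :> R by field.
  rewrite /cval; lra.
(* [fval k k] is [k / 2 - 1], positive since [k >= 3]. *)
rewrite /fval divnn k0 divff //= exp1n; lra.
Qed.

(** * Information matrices *)

Section Information.
Variables (R : realType) (t b k : nat).
Implicit Types (d : design t b k) (l : {ffun 'I_k -> 'I_t}).

Local Notation T := (Tmat R).
Local Notation L := (Lmat R).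
Local Notation B := (Bmat R b k).
Local Notation X1 := (X1mat R).
Local Notation X2 := (X2mat R).

Lemma sum_obs (F : 'I_b -> 'I_k -> R) :
  \sum_(r < nobs b k) F (Defs.decode r).1 (Defs.decode r).2 = \sum_u \sum_j F u j.
Proof.
rewrite pair_bigA /= [RHS](reindex (@Defs.decode b k)) //.
exact/onW_bij/enum_val_bij.
Qed.

Lemma sum_pred1 n (x : 'I_n) : \sum_(i < n) (x == i)%:R = 1 :> R.
Proof.
rewrite (bigD1 x) //= eqxx big1 ?addr0 // => i ix.
by rewrite eq_sym (negbTE ix).
Qed.

Lemma gram_Kmat : (Kmat R t)^T *m Kmat R t = 2%:M.
Proof. by rewrite tr_col_mx trmx1 mul_row_col mulmx1 -raddfD. Qed.

Lemma X1matE d : X1 d = 2^-1 *: (T d + L d).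
Proof.
rewrite /X1mat gram_Kmat mpinv_scalar ?pnatr_eq0 // mul_mx_scalar.
by rewrite mul_row_col !mulmx1.
Qed.

(** [Mmat] projects onto the orthogonal complement of the columns of [K], spanned by the differences
    of direct and left-neighbour effects. *)
Lemma mul_Amat_Mmat d :
  Amat R d *m Mmat R t =
  row_mx (2^-1 *: (T d - L d)) (- (2^-1 *: (T d - L d))).
Proof.
rewrite /Mmat gram_Kmat mpinv_scalar ?pnatr_eq0 // mul_mx_scalar.
rewrite mulmxBr mulmx1 -scalemxAl -scalemxAr mulmxA mul_row_col !mulmx1.
rewrite tr_col_mx trmx1 mul_mx_row mulmx1 scale_row_mx opp_row_mx add_row_mx.
by congr row_mx; apply/matrixP => i j; rewrite !mxE; field.
Qed.

Lemma gram_Bmat : B^T *m B = k%:R%:M.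
Proof.
apply/matrixP => u u'; rewrite !mxE.
transitivity (\sum_r ((@Defs.decode b k r).1 == u)%:R * ((Defs.decode r).1 == u')%:R : R).
  by apply: eq_bigr => r _; rewrite !mxE.
rewrite (sum_obs (fun v _ => (v == u)%:R * (v == u')%:R)) (bigD1 u) //=.
rewrite [X in _ + X]big1 => [|v /negbTE vu]; last first.
  by rewrite big1 // => j _; rewrite vu mul0r.
by rewrite sumr_const card_ord eqxx mul1r addr0 mulrnAC.
Qed.

Lemma projperp_X2_Bmat d : projperp (X2 d) *m B = 0.
Proof.
by have := projperpX (X2 d); rewrite {2}/X2mat mul_mx_row -row_mx0 => /eq_row_mx[].
Qed.

Lemma info_gram d :
  info R d = (projperp (X2 d) *m X1 d)^T *m (projperp (X2 d) *m X1 d).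
Proof.
by rewrite trmx_mul projperp_sym mulmxA -[_ *m _ *m projperp _]mulmxA projperp_idem.
Qed.

Lemma nnd_info d : nnd (info R d).
Proof. by rewrite info_gram; exact: nnd_gram. Qed.

(** The rows of [(T + L) / 2] and of [B] all sum to one, so [X1] maps the all-ones vector into the
    block space, which [projperp] kills. *)
Lemma info_row_sum d : info R d *m (const_mx 1 : 'cV_t) = 0.
Proof.
suff E : X1 d *m (const_mx 1 : 'cV_t) = B *m (const_mx 1 : 'cV_b).
  by rewrite /info -mulmxA E -mulmxA (mulmxA (projperp _)) projperp_X2_Bmat mul0mx mulmx0.
have sum1 n (x : 'I_n) : \sum_(i < n) (x == i)%:R * 1 = 1 :> R.
  by rewrite -mulr_suml sum_pred1 mul1r.
rewrite X1matE -scalemxAl mulmxDl; apply/matrixP => r j; rewrite !mxE.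
under eq_bigr do rewrite !mxE; under [X in _ + X]eq_bigr do rewrite !mxE.
by under [RHS]eq_bigr do rewrite !mxE; rewrite !sum1; field.
Qed.

(* The residual of [X1] after the block effects alone: [C_d] is at most the
   Gram matrix of [centered d], with equality when the remaining columns
   [T - L] of [X2] are orthogonal to it. *)
Definition centered d : 'M[R]_(nobs b k, t) :=
  X1 d - k%:R^-1 *: (B *m (B^T *m X1 d)).

Lemma info_centered d :
  info R d = (centered d)^T *m projperp (X2 d) *m centered d.
Proof.
have E : projperp (X2 d) *m centered d = projperp (X2 d) *m X1 d.
  by rewrite mulmxBr -scalemxAr (mulmxA _ B) projperp_X2_Bmat mul0mx scaler0 subr0.
by rewrite info_gram -E trmx_mul projperp_sym mulmxA
  -[_ *m _ *m projperp _]mulmxA projperp_idem.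
Qed.

Lemma mxtrace_info_le d : \tr (info R d) <= \tr ((centered d)^T *m centered d).
Proof. by rewrite info_centered mxtrace_projperp_le. Qed.

Hypothesis k_gt0 : (0 < k)%N.

Lemma Bmat_centered d : B^T *m centered d = 0.
Proof.
rewrite mulmxBr -scalemxAr (mulmxA _ B) gram_Bmat mul_scalar_mx scalerA.
by rewrite mulVf ?scale1r ?subrr // pnatr_eq0 -lt0n.
Qed.

Lemma gram_centered d : (centered d)^T *m centered d =
  (X1 d)^T *m X1 d - k%:R^-1 *: ((B^T *m X1 d)^T *m (B^T *m X1 d)).
Proof.
rewrite {2}/centered mulmxBr -scalemxAr (mulmxA _ B).
have -> : (centered d)^T *m B = 0.
  by rewrite -[B]trmxK -trmx_mul Bmat_centered trmx0.
rewrite mul0mx scaler0 subr0 /centered linearB /= linearZ /= mulmxBl.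
by rewrite -scalemxAl [(B *m _)^T]trmx_mul -mulmxA.
Qed.

(** Position [j] of the inner sequence is plot [j + 1], so plot [j] is its left neighbour; for
    [j = 0] this is the border plot, which repeats plot [k]. *)
Lemma border_circular d u (j : 'I_k) :
  circular d -> d u (inord j) = inner_seq d u (ord_pred j).
Proof.
move=> /(_ u)[d0 _]; rewrite ffunE /=.
case: (posnP j) => [j0|j0].
  rewrite j0 add0n modn_small ?prednK // -d0; congr (d u _).
  by apply: val_inj; rewrite /= inordK.
have -> : ((j + k).-1 = j.-1 + k)%N by lia.
rewrite modnDr modn_small ?prednK //.
by have := ltn_ord j; lia.
Qed.

Lemma TmatE d r i :
  T d r i = (inner_seq d (Defs.decode r).1 (Defs.decode r).2 == i)%:R.
Proof. by rewrite mxE ffunE. Qed.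

Lemma LmatE d r i : circular d ->
  L d r i = (inner_seq d (Defs.decode r).1 (ord_pred (Defs.decode r).2) == i)%:R.
Proof. by move=> dc; rewrite mxE border_circular. Qed.

Lemma X1mat_entry d r i : circular d ->
  X1 d r i = 2^-1 * ((inner_seq d (Defs.decode r).1 (Defs.decode r).2 == i)%:R
    + (inner_seq d (Defs.decode r).1 (ord_pred (Defs.decode r).2) == i)%:R).
Proof. by move=> dc; rewrite X1matE mxE [X in _ * X]mxE TmatE LmatE. Qed.

Lemma n_occE l i : (n_occ l i)%:R = \sum_j (l j == i)%:R :> R.
Proof. by rewrite -natr_sum -big_mkcond sum1dep_card. Qed.

Lemma n_occ_predE l i : (n_occ l i)%:R = \sum_j (l (ord_pred j) == i)%:R :> R.
Proof. by rewrite n_occE (reindex_inj (bij_inj (ord_pred_bij k))). Qed.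

Lemma Bmat_mulE (F : 'I_b -> 'I_k -> R) (X : 'M_(nobs b k, t)) u i :
  (forall r, X r i = F (Defs.decode r).1 (Defs.decode r).2) ->
  (B^T *m X) u i = \sum_j F u j.
Proof.
move=> XF; rewrite mxE.
transitivity (\sum_r ((@Defs.decode b k r).1 == u)%:R * F (Defs.decode r).1 (Defs.decode r).2).
  by apply: eq_bigr => r _; rewrite !mxE XF.
rewrite (sum_obs (fun v j => (v == u)%:R * F v j)) (bigD1 u) //=.
rewrite [X in _ + X]big1 => [|v /negbTE vu]; last first.
  by rewrite big1 // => j _; rewrite vu mul0r.
by rewrite addr0; apply: eq_bigr => j _; rewrite eqxx mul1r.
Qed.

Lemma Bmat_Tmat d u i : (B^T *m T d) u i = (n_occ (inner_seq d u) i)%:R.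
Proof.
rewrite (Bmat_mulE (F := fun u j => (inner_seq d u j == i)%:R)) ?n_occE // => r.
exact: TmatE.
Qed.

Lemma Bmat_Lmat d u i :
  circular d -> (B^T *m L d) u i = (n_occ (inner_seq d u) i)%:R.
Proof.
move=> dc; rewrite n_occ_predE.
rewrite (Bmat_mulE (F := fun u j => (inner_seq d u (ord_pred j) == i)%:R)) // => r.
exact: LmatE.
Qed.

Lemma Bmat_X1mat d u i :
  circular d -> (B^T *m X1 d) u i = (n_occ (inner_seq d u) i)%:R.
Proof.
move=> dc; rewrite X1matE -scalemxAr mulmxDr 2!mxE.
by rewrite Bmat_Tmat Bmat_Lmat //; field.
Qed.

(** The information carried by a block with inner sequence [l] when only block effects are
    eliminated. *)
Definition block_info l : 'M[R]_t := \matrix_(i, j)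
  (4^-1 * \sum_p ((l p == i)%:R + (l (ord_pred p) == i)%:R)
                 * ((l p == j)%:R + (l (ord_pred p) == j)%:R)
   - k%:R^-1 * ((n_occ l i)%:R * (n_occ l j)%:R)).

Lemma gram_centeredE d : circular d ->
  (centered d)^T *m centered d = \sum_u block_info (inner_seq d u).
Proof.
move=> dc; rewrite gram_centered; apply/matrixP => i j.
rewrite summxE; under [RHS]eq_bigr do rewrite mxE.
rewrite sumrB -!mulr_sumr !mxE; congr (_ - _ * _); last first.
  by apply: eq_bigr => u _; rewrite [_^T _ _]mxE !Bmat_X1mat.
pose F u p := 4^-1 *
  (((inner_seq d u p == i)%:R + (inner_seq d u (ord_pred p) == i)%:R)
    * ((inner_seq d u p == j)%:R + (inner_seq d u (ord_pred p) == j)%:R)) : R.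
transitivity (\sum_r F (@Defs.decode b k r).1 (Defs.decode r).2).
  by apply: eq_bigr => r _; rewrite mxE !X1mat_entry // /F; field.
by rewrite (sum_obs F) mulr_sumr; apply: eq_bigr => u _; rewrite mulr_sumr.
Qed.

(** The square of a sum of two indicators is their sum plus twice their product. Over all positions
    and treatments the sums give [2 k] and the products count the [m_occ]. *)
Lemma mxtrace_block_info l : \tr (block_info l) = cval R l.
Proof.
rewrite /mxtrace; under eq_bigr do rewrite mxE.
rewrite sumrB -!mulr_sumr exchange_big /= /cval.
have -> : \sum_i (n_occ l i)%:R * (n_occ l i)%:R = \sum_i (n_occ l i ^ 2)%:R :> R.
  by apply: eq_bigr => i _; rewrite natrX expr2.
have -> : \sum_p \sum_i ((l p == i)%:R + (l (ord_pred p) == i)%:R)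
    * ((l p == i)%:R + (l (ord_pred p) == i)%:R)
  = 2 * k%:R + 2 * \sum_(i < t) (m_occ l i)%:R :> R.
  have -> : \sum_i (m_occ l i)%:R
      = \sum_p \sum_i ((l (ord_pred p) == i) && (l p == i))%:R :> R.
    rewrite exchange_big /=; apply: eq_bigr => i _.
    by rewrite -natr_sum -big_mkcond sum1dep_card.
  have -> : k%:R = \sum_(p < k) 1 :> R by rewrite sumr_const card_ord.
  rewrite !mulr_sumr -big_split; apply: eq_bigr => p _ /=.
  have -> : 2 * 1 = \sum_i ((l p == i)%:R + (l (ord_pred p) == i)%:R) :> R.
    by rewrite big_split /= !sum_pred1; ring.
  rewrite mulr_sumr -big_split; apply: eq_bigr => i _ /=.
  by case: (l p == i); case: (l (ord_pred p) == i) => /=; ring.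
by field; rewrite pnatr_eq0 -lt0n.
Qed.

Lemma mxtrace_gram_centered d : circular d ->
  \tr ((centered d)^T *m centered d) = \sum_u cval R (inner_seq d u).
Proof.
move=> dc; rewrite gram_centeredE // raddf_sum.
by apply: eq_bigr => u _; exact: mxtrace_block_info.
Qed.

Lemma relabelE (s : {perm 'I_t}) l j : relabel s l j = s (l j).
Proof. exact: ffunE. Qed.

Lemma block_info_relabel (s : {perm 'I_t}) l i j :
  block_info (relabel s l) (s i) (s j) = block_info l i j.
Proof.
have nE x : n_occ (relabel s l) (s x) = n_occ l x.
  by apply: eq_card => p; rewrite !inE relabelE (inj_eq perm_inj).
rewrite !mxE !nE; congr (_ * _ - _); apply: eq_bigr => p _.
by rewrite !relabelE !(inj_eq perm_inj).
Qed.

Lemma cval_relabel (s : {perm 'I_t}) l : cval R (relabel s l) = cval R l.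
Proof.
rewrite -!mxtrace_block_info /mxtrace (reindex_inj (@perm_inj _ s)).
by apply: eq_bigr => i _; rewrite block_info_relabel.
Qed.

(** Within each block, the rows of [L] are a cyclic shift of those of [T]. *)
Lemma gram_Tmat_Lmat d : circular d -> (T d)^T *m T d = (L d)^T *m L d.
Proof.
move=> dc; apply/matrixP => i j; rewrite !mxE.
transitivity (\sum_u \sum_p (inner_seq d u p == i)%:R * (inner_seq d u p == j)%:R : R).
  rewrite -(sum_obs (fun u p => (inner_seq d u p == i)%:R * (inner_seq d u p == j)%:R)).
  by apply: eq_bigr => r _; rewrite mxE !TmatE.
transitivity (\sum_u \sum_p (inner_seq d u (ord_pred p) == i)%:R
    * (inner_seq d u (ord_pred p) == j)%:R : R).
  by apply: eq_bigr => u _; rewrite (reindex_inj (bij_inj (ord_pred_bij k))).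
rewrite -(sum_obs (fun u p => (inner_seq d u (ord_pred p) == i)%:R
    * (inner_seq d u (ord_pred p) == j)%:R)).
by apply: eq_bigr => r _; rewrite mxE !LmatE.
Qed.

(** Here [(T - L)' (T + L) = 0], and [(T - L)' B = 0] because circularity gives each treatment equal
    counts in a block as direct and as left-neighbour treatment. So [X2] is orthogonal to
    [centered d]. *)
Lemma info_eq_gram_centered d : circular d ->
  (T d)^T *m L d = (L d)^T *m T d -> info R d = (centered d)^T *m centered d.
Proof.
move=> dc TL; rewrite info_centered -mulmxA.
suff X2Y : (X2 d)^T *m centered d = 0.
  by rewrite /projperp mulmxBl mul1mx /proj -(mulmxA _ _ (centered d)) X2Y mulmx0 subr0.
have DY : (T d - L d)^T *m centered d = 0.
  rewrite mulmxBr -scalemxAr (mulmxA _ B).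
  have -> : (T d - L d)^T *m B = 0.
    have BTL : B^T *m T d = B^T *m L d.
      by apply/matrixP => u i; rewrite Bmat_Tmat Bmat_Lmat.
    by rewrite -[B]trmxK -trmx_mul mulmxBr BTL subrr trmx0.
  rewrite mul0mx scaler0 subr0 X1matE -scalemxAr linearB /= mulmxBl !mulmxDr.
  by rewrite TL gram_Tmat_Lmat // [X in X - _]addrC subrr scaler0.
rewrite /X2mat mul_Amat_Mmat !tr_row_mx !mul_col_mx Bmat_centered.
have DY' : (2^-1 *: (T d - L d))^T *m centered d = 0.
  by rewrite linearZ /= -scalemxAl DY scaler0.
by rewrite linearN /= mulNmx DY' oppr0 !col_mx0.
Qed.

(** * Designs whose blocks are invariant under relabelling *)

Section Invariant.
Variable d : design t b k.
Hypothesis d_circ : circular d.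
(** Invariance of the multiset of inner sequences, phrased through sums of arbitrary functions over
    the blocks. *)
Hypothesis d_inv : forall (s : {perm 'I_t}) (F : {ffun 'I_k -> 'I_t} -> R),
  \sum_u F (relabel s (inner_seq d u)) = \sum_u F (inner_seq d u).

(** Relabelling by the transposition of [i] and [j] exchanges the entries [(i, j)] and [(j, i)] of
    [T' L]. *)
Lemma trmx_Tmat_Lmat : (T d)^T *m L d = (L d)^T *m T d.
Proof.
pose F i j l : R := \sum_p (l p == i)%:R * (l (ord_pred p) == j)%:R.
have TLE i j : ((T d)^T *m L d) i j = \sum_u F i j (inner_seq d u).
  rewrite mxE -(sum_obs (fun u p => (inner_seq d u p == i)%:R
    * (inner_seq d u (ord_pred p) == j)%:R)).
  by apply: eq_bigr => r _; rewrite mxE TmatE LmatE.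
have -> : (L d)^T *m T d = ((T d)^T *m L d)^T by rewrite trmx_mul trmxK.
apply/matrixP => i j; rewrite [RHS]mxE !TLE -(d_inv (tperm i j)).
apply: eq_bigr => u _; apply: eq_bigr => p _.
rewrite !relabelE -[inner_seq d u p == j](inj_eq (@perm_inj _ (tperm i j))) tpermR.
by rewrite -[inner_seq d u (ord_pred p) == i](inj_eq (@perm_inj _ (tperm i j))) tpermL.
Qed.

Lemma info_invariantE : info R d = (centered d)^T *m centered d.
Proof. exact: info_eq_gram_centered trmx_Tmat_Lmat. Qed.

Lemma info_invariant (s : {perm 'I_t}) i j : info R d (s i) (s j) = info R d i j.
Proof.
rewrite info_invariantE gram_centeredE // !summxE.
rewrite -(d_inv s (fun l => block_info l (s i) (s j))).
by apply: eq_bigr => u _; rewrite block_info_relabel.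
Qed.

End Invariant.

End Information.

(** * Universal optimality *)

Section Kiefer.
Variables (R : realType) (t : nat).
Implicit Types (C : 'M[R]_t) (Phi : 'M[R]_t -> \bar R).

Lemma nnd_scale_add C C' (a a' : R) : 0 <= a -> 0 <= a' -> nnd C -> nnd C' ->
  nnd (a *: C + a' *: C').
Proof.
move=> a0 a'0 [Cs C0] [C's C'0]; split=> [|x].
  by rewrite linearD !linearZ /= Cs C's.
rewrite mulmxDr mulmxDl -!scalemxAr -!scalemxAl mxE [X in X + _]mxE [X in _ + X]mxE.
by rewrite addr_ge0 ?mulr_ge0.
Qed.

Lemma nnd_permute C (s : {perm 'I_t}) :
  nnd C -> nnd (\matrix_(i, j) C (s i) (s j)).
Proof.
move=> [Cs C0]; split=> [|x].
  by apply/matrixP => i j; rewrite !mxE -[in LHS]Cs mxE.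
(* The form of the permuted matrix at [x] is that of [C] at [x] with permuted coordinates. *)
have := C0 (\col_i x (s^-1%g i) 0); congr (0 <= _).
rewrite !mxE (reindex_inj (@perm_inj _ s)); apply: eq_bigr => j _ /=.
rewrite !mxE permK (reindex_inj (@perm_inj _ s)); congr (_ * _).
by apply: eq_bigr => i _; rewrite !mxE permK.
Qed.

(** Sublevel sets of [Phi] are convex. By induction, a mean of [n + 1] matrices is a convex
    combination of the first and the mean of the others. *)
Lemma mean_quasiconvex Phi (I : Type) (r : seq I) (F : I -> 'M[R]_t) (c : \bar R) :
  kiefer_criterion Phi -> (forall i, nnd (F i)) -> (forall i, (Phi (F i) <= c)%E) ->
  (0 < size r)%N ->
  let mean := (size r)%:R^-1 *: \sum_(i <- r) F i in
  nnd mean /\ (Phi mean <= c)%E.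
Proof.
move=> [PhiNy Phi_conv _ _] F0 Fc; case: r => // x r _ /=.
(* This leaves [c] finite, where the convexity bound is real arithmetic, or [+oo], where nothing is
   to be shown. *)
have c_ny : c != -oo%E.
  apply: contraNneq (PhiNy _ (F0 x)) => cE.
  by have := Fc x; rewrite cE leeNy_eq.
have sublevel A B (a : R) : nnd A -> nnd B -> 0 < a -> a < 1 ->
    (Phi A <= c)%E -> (Phi B <= c)%E -> (Phi (a *: A + (1 - a) *: B)%R <= c)%E.
  move=> A0 B0 a0 a1 Ac Bc; apply: le_trans (Phi_conv _ _ _ A0 B0 a0 a1) _.
  move: c c_ny Ac Bc {Fc} => [c| |] // _ Ac Bc; last by rewrite leey.
  apply: (@le_trans _ _ (a%:E * c%:E + (1 - a)%:E * c%:E)%E).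
    by apply: leeD; apply: lee_wpmul2l => //; rewrite lee_fin; lra.
  by rewrite -!EFinM -EFinD lee_fin -mulrDl addrC subrK mul1r.
elim: r x => [|y r IH] x /=; first by rewrite big_seq1 invr1 scale1r.
rewrite big_cons; have [S0 Sc] := IH y.
set S := \sum_(i <- _) _ in S0 Sc *; set n := (size r).+1 in S0 Sc *.
have n0 : (0 : R) < n%:R by rewrite ltr0n.
pose a : R := n.+1%:R^-1.
have a0 : 0 < a by rewrite invr_gt0.
have a1 : a < 1 by rewrite invf_lt1 // ltr1n.
have -> : n.+1%:R^-1 *: (F x + S) = a *: F x + (1 - a) *: (n%:R^-1 *: S).
  rewrite scalerDr scalerA; congr (_ + _ *: _).
  by rewrite /a -natr1; field; rewrite natr1 !pnatr_eq0 -lt0n -(ltr0n R) n0.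
split; first by apply: nnd_scale_add => //; lra.
exact: sublevel.
Qed.

Lemma row_sumE C : C *m (const_mx 1 : 'cV_t) = 0 -> forall i, \sum_j C i j = 0.
Proof.
move=> /matrixP C1 i; have := C1 i 0; rewrite !mxE => E; rewrite -[RHS]E.
by apply: eq_bigr => j _; rewrite mxE mulr1.
Qed.

(** Transpositions make all diagonal entries equal and all off-diagonal entries equal; the zero row
    sums fix their ratio, and the trace the scale. *)
Lemma completely_symmetric C : (1 < t)%N ->
  (forall (s : {perm 'I_t}) i j, C (s i) (s j) = C i j) ->
  C *m (const_mx 1 : 'cV_t) = 0 ->
  C = (\tr C / t.-1%:R) *: (1%:M - const_mx t%:R^-1).
Proof.
move=> t1 Cinv /row_sumE C1.
have tm0 : t.-1%:R != 0 :> R by rewrite pnatr_eq0; lia.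
have tE : t%:R = t.-1%:R + 1 :> R by rewrite natr1 prednK //; lia.
have t0 : t.-1%:R + 1 != 0 :> R by rewrite -tE pnatr_eq0; lia.
have diag i j : C i i = C j j by rewrite -(Cinv (tperm i j)) tpermL.
have trE i : \tr C = t%:R * C i i.
  rewrite /mxtrace (eq_bigr (fun _ => C i i)) => [|j _]; last exact: diag.
  by rewrite sumr_const card_ord mulr_natl.
have off i j j' : j != i -> j' != i -> C i j = C i j'.
  move=> ji j'i; rewrite -(Cinv (tperm j j')) tpermL tpermD //.
have offE i j : j != i -> C i i = - t.-1%:R * C i j.
  move=> ji; have := C1 i; rewrite (bigD1 i) //=.
  rewrite (eq_bigr (fun _ => C i j)) => [|j' j'i]; last exact: off.
  rewrite sumr_const (eq_card (B := predC1 i)) // cardC1 card_ord => /eqP.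
  by rewrite addr_eq0 mulNr mulr_natl => /eqP.
apply/matrixP => i j; rewrite !mxE (trE i) tE.
have [<-|ij] := eqVneq i j; first by rewrite mulr1n; field; rewrite t0 tm0.
by rewrite mulr0n (offE i j) 1?eq_sym //; field; rewrite t0 tm0.
Qed.

(** Summing over a list gives this average the shape required by [mean_quasiconvex]. *)
Definition symmetrization C : 'M[R]_t :=
  #|{perm 'I_t}|%:R^-1 *:
    \sum_(s <- enum {perm 'I_t}) (\matrix_(i, j) C (s i) (s j)).

Lemma symmetrization_entry C i j :
  symmetrization C i j =
    #|{perm 'I_t}|%:R^-1 * \sum_(s : {perm 'I_t}) C (s i) (s j).
Proof.
rewrite mxE summxE big_enum /=; congr (_ * _).
by apply: eq_bigr => s _; rewrite mxE.
Qed.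

Lemma card_perm_neq0 : #|{perm 'I_t}|%:R != 0 :> R.
Proof. by rewrite pnatr_eq0 -lt0n; apply/card_gt0P; exists 1%g. Qed.

Lemma symmetrization_invariant C (s : {perm 'I_t}) i j :
  symmetrization C (s i) (s j) = symmetrization C i j.
Proof.
rewrite !symmetrization_entry; congr (_ * _).
rewrite [RHS](reindex_inj (mulgI s)); apply: eq_bigr => s' _.
by rewrite !permM.
Qed.

Lemma mxtrace_symmetrization C : \tr (symmetrization C) = \tr C.
Proof.
rewrite /mxtrace (eq_bigr _ (fun i _ => symmetrization_entry C i i)).
rewrite -mulr_sumr exchange_big /= (eq_bigr (fun _ => \tr C)).
  rewrite sumr_const mulrnAr -mulrnAl -[_^-1 *+ _]mulr_natr mulVf ?mul1r //.
  exact: card_perm_neq0.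
by move=> s _; rewrite /mxtrace [RHS](reindex_inj (@perm_inj _ s)).
Qed.

Lemma symmetrization_row_sum C :
  C *m (const_mx 1 : 'cV_t) = 0 -> symmetrization C *m (const_mx 1 : 'cV_t) = 0.
Proof.
move=> /row_sumE C1; apply/matrixP => i z; rewrite !mxE.
transitivity (\sum_j symmetrization C i j).
  by apply: eq_bigr => j _; rewrite [const_mx _ _ _]mxE mulr1.
rewrite (eq_bigr _ (fun j _ => symmetrization_entry C i j)).
rewrite -mulr_sumr exchange_big /= big1 ?mulr0 // => s _.
by rewrite -[RHS](C1 (s i)) [RHS](reindex_inj (@perm_inj _ s)).
Qed.

Lemma nnd_trace_ge0 C : nnd C -> 0 <= \tr C.
Proof.
move=> [_ C0]; apply: sumr_ge0 => i _.
have := C0 (delta_mx i 0).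
by rewrite trmx_delta -rowE -colE !mxE.
Qed.

(** The centering matrix is symmetric and idempotent, hence its own Gram matrix. *)
Lemma nnd_centering : (0 < t)%N -> nnd (1%:M - const_mx t%:R^-1 : 'M[R]_t).
Proof.
move=> t0; have tR : t%:R != 0 :> R by rewrite pnatr_eq0 -lt0n.
set J : 'M_t := 1%:M - _.
have Js : J^T = J by rewrite linearB /= trmx1 trmx_const.
suff -> : J = J^T *m J by exact: nnd_gram.
rewrite Js mulmxBr mulmx1 mulmxBl mul1mx -[LHS]subr0; congr (_ - _).
apply/esym/matrixP => i j; rewrite !mxE.
under eq_bigr do rewrite !mxE.
by rewrite sumr_const card_ord -mulrnAl -[_^-1 *+ t]mulr_natr mulVf // mul1r subrr.
Qed.

(* Kiefer's criterion: averaging a competitor over relabellings does not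
   increase [Phi] and leaves a multiple of the centering matrix, whose
   multiplier is proportional to the trace. *)
Lemma kiefer_optimal Phi C C' : (1 < t)%N -> kiefer_criterion Phi ->
  nnd C -> C *m (const_mx 1 : 'cV_t) = 0 ->
  C' *m (const_mx 1 : 'cV_t) = 0 ->
  (forall (s : {perm 'I_t}) i j, C' (s i) (s j) = C' i j) ->
  \tr C <= \tr C' -> (Phi C' <= Phi C)%E.
Proof.
move=> t1 PhiK C0 C1 C'1 C'inv trCC'.
have t0 : (0 < t)%N by exact: ltnW.
have [_ _ Phi_scale Phi_perm] := PhiK.
have : (Phi (symmetrization C) <= Phi C)%E.
  rewrite /symmetrization cardE.
  have [] // := mean_quasiconvex (r := enum {perm 'I_t})
    (F := fun s : {perm 'I_t} => \matrix_(i, j) C (s i) (s j)) (c := Phi C) PhiK.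
  - by move=> s; exact: nnd_permute.
  - by move=> s; rewrite Phi_perm.
  - by rewrite -cardE; apply/card_gt0P; exists 1%g.
apply: le_trans.
rewrite (completely_symmetric t1 (symmetrization_invariant C)
  (symmetrization_row_sum C1)) (completely_symmetric t1 C'inv C'1).
rewrite mxtrace_symmetrization; apply: Phi_scale; first exact: nnd_centering.
  by rewrite divr_ge0 ?nnd_trace_ge0.
by rewrite ler_wpM2r ?invr_ge0.
Qed.

End Kiefer.

(** The number of blocks with a given inner sequence is constant on the orbit of [l] and zero off
    it, so relabelling preserves it. *)
Lemma sum_inner_seq_relabel (R : realType) (t b k : nat) (d : design t b k)
    (l : {ffun 'I_k -> 'I_t}) (r : nat) :
  (forall u, exists s : {perm 'I_t}, inner_seq d u = relabel s l) ->
  (forall s : {perm 'I_t}, #|[set u | inner_seq d u == relabel s l]| = r) ->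
  forall (s : {perm 'I_t}) (F : {ffun 'I_k -> 'I_t} -> R),
    \sum_u F (relabel s (inner_seq d u)) = \sum_u F (inner_seq d u).
Proof.
move=> d_orbit d_unif s F.
pose cnt l' := #|[set u | inner_seq d u == l']|.
have sumE (G : {ffun 'I_k -> 'I_t} -> R) :
    \sum_u G (inner_seq d u) = \sum_l' G l' *+ cnt l'.
  rewrite (partition_big (inner_seq d) xpredT) //=; apply: eq_bigr => l' _.
  rewrite (eq_bigr (fun=> G l')) => [|u /eqP -> //].
  by rewrite sumr_const; congr (_ *+ _); apply: eq_card => u; rewrite inE.
have relabelM s1 s2 l' : relabel s1 (relabel s2 l') = relabel (s2 * s1)%g l'.
  by apply/ffunP => j; rewrite !ffunE permM.
have relabel_inj : injective (@relabel t k s).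
  move=> l1 l2 /ffunP E; apply/ffunP => j; have := E j.
  by rewrite !ffunE => /perm_inj.
have cnt0 l' : (forall s', l' <> relabel s' l) -> cnt l' = 0%N.
  move=> N; apply/eqP; rewrite cards_eq0; apply/eqP/setP => u; rewrite !inE.
  apply/eqP => E; have [s' E'] := d_orbit u.
  by apply: (N s'); rewrite -E.
have cnt_inv l' : cnt (relabel s l') = cnt l'.
  have [/existsP[s' /eqP ->]|/existsPn N] :=
    boolP [exists s' : {perm 'I_t}, l' == relabel s' l].
    by rewrite relabelM /cnt !d_unif.
  rewrite !cnt0 // => s' E; first by have := N s'; rewrite E eqxx.
  (* If relabelling [l'] by [s] lands in the orbit, undoing [s] puts [l'] itself there. *)
  have := N (s' * s^-1)%g; rewrite -relabelM -E relabelM mulgV.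
  suff -> : relabel 1%g l' = l' by rewrite eqxx.
  by apply/ffunP => j; rewrite ffunE perm1.
rewrite (sumE (fun l' => F (relabel s l'))) sumE [RHS](reindex_inj relabel_inj).
by apply: eq_bigr => l' _; rewrite cnt_inv.
Qed.

Theorem theorem10 (R : realType) (t b k : nat)
  (hb : (0 < b)%N) (hk3 : (3 <= k)%N) (hkt : (k <= t)%N)
  (lstar : {ffun 'I_k -> 'I_t})
  (hmax : forall l : {ffun 'I_k -> 'I_t}, cval R l <= cval R lstar)
  (dstar : design t b k)
  (hcirc : circular dstar)
  (hin : forall i : 'I_b, exists s : {perm 'I_t}, inner_seq dstar i = relabel s lstar)
  (heq : exists r : nat, forall s : {perm 'I_t},
           #|[set i : 'I_b | inner_seq dstar i == relabel s lstar]| = r) :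
  universally_optimal R dstar /\
  \tr (info R dstar) = b%:R * fval R k (ndistinct lstar) /\
  \tr (info R dstar) = b%:R * cval R lstar.
Proof.
have k0 : (0 < k)%N by exact: leq_trans hk3.
have [r hr] := heq.
have dinv := sum_inner_seq_relabel (R := R) hin hr.
have trE : \tr (info R dstar) = b%:R * cval R lstar.
  rewrite info_invariantE // mxtrace_gram_centered //.
  rewrite (eq_bigr (fun=> cval R lstar)) => [|u _].
    by rewrite sumr_const card_ord mulr_natl.
  by have [s ->] := hin u; rewrite cval_relabel.
split; last by rewrite -cval_max_eq_fval.
move=> Phi PhiK d dcirc; apply: kiefer_optimal => //.
- by apply: leq_trans hkt; exact: leq_trans hk3.
- exact: nnd_info.
- exact: info_row_sum.
- exact: info_row_sum.
- exact: info_invariant.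
(* The competitor's trace is at most the sum of its block values, each bounded by the maximum. *)
apply: le_trans (mxtrace_info_le R d) _.
rewrite mxtrace_gram_centered // trE mulr_natl -[b in leRHS]card_ord -sumr_const.
by apply: ler_sum.
Qed.
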